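(* There exist a finite index subgroup $G$ of $\mathbb{Q}^\times$ and non-zero integers $a,b,c$ such that the equation $ax+by+cz=0$ has no solution with $x,y,z\in G$, but for each place $v$ of $\mathbb{Q}$ the equation has a solution with $x,y,z\in G_{\{v\}}$, where $G_{\{v\}}$ is the completion (i.e. the closure) of $G$ in $\mathbb{Q}_v^\times$.
   Context: Places of $\mathbb{Q}$ are the primes $p$ and the archimedean place $\infty$, with completions $\mathbb{Q}_p$ and $\mathbb{Q}_\infty=\mathbb{R}$. *)

(* Defs.v *)
From HB Require Import structures.
From mathcomp Require Import all_boot all_order all_algebra.
From mathcomp Require Import ring.
From mathcomp Require Import generic_quotient ring_quotient.
From mathcomp Require Import all_classical all_reals topology normedtype.

Set Implicit Arguments.
Unset Strict Implicit.
Unset Printing Implicit Defensive.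

Import Order.TTheory GRing.Theory Num.Theory.
Import numFieldNormedType.Exports.

Local Open Scope classical_set_scope.
Local Open Scope ring_scope.

Definition padic_val (p : nat) (x : rat) : int :=
  (logn p `|numq x|)%:Z - (logn p `|denq x|)%:Z.

Definition padic_abs (p : nat) (x : rat) : rat :=
  if x == 0 then 0 else p%:Q ^ (- padic_val p x).

Section PadicAbs.
Variables (p : nat) (p_pr : prime p).
Local Notation "'abs" := (padic_abs p).

Let p_gt1 : 1 < p%:Q. Proof. by rewrite ltr1n prime_gt1. Qed.
Let p_gt0 : 0 < p%:Q. Proof. exact: lt_trans p_gt1. Qed.

Lemma padic_val_frac (a b : int) : a != 0 -> b != 0 ->
  padic_val p (a%:Q / b%:Q) = (logn p `|a|)%:Z - (logn p `|b|)%:Z.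
Proof.
move=> a0 b0; set x := a%:Q / b%:Q.
have x0 : x != 0 by rewrite mulf_neq0 ?invr_eq0 ?intr_eq0.
have E : a * denq x = numq x * b.
  apply/eqP; rewrite -(eqr_int rat) !intrM.
  have : x * (denq x)%:~R = (numq x)%:~R by rewrite numqE.
  by move=> <-; rewrite /x mulrAC divfK // intr_eq0.
have /(congr1 (fun z : int => logn p `|z|%N)) := E.
rewrite !abszM !lognM ?absz_gt0 ?numq_eq0 ?denq_eq0 // => e.
rewrite /padic_val; apply/eqP; rewrite subr_eq addrAC eq_sym subr_eq.
by rewrite -!PoszD e addnC.
Qed.

Lemma padic_valM x y : x != 0 -> y != 0 ->
  padic_val p (x * y) = padic_val p x + padic_val p y.
Proof.
move=> x0 y0.
have -> : x * y = (numq x * numq y)%:Q / (denq x * denq y)%:Q.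
  by rewrite -{1}(divq_num_den x) -{1}(divq_num_den y) !intrM mulf_div.
rewrite padic_val_frac ?mulf_neq0 ?numq_eq0 ?denq_eq0 //.
rewrite !abszM !lognM ?absz_gt0 ?numq_eq0 ?denq_eq0 // /padic_val !PoszD.
by rewrite opprD addrACA.
Qed.

Lemma padic_abs0 : 'abs 0 = 0. Proof. by rewrite /padic_abs eqxx. Qed.

Lemma padic_abs_ge0 x : 0 <= 'abs x.
Proof. by rewrite /padic_abs; case: ifP => // _; exact/exprz_ge0/ltW. Qed.

Lemma padic_abs_eq0 x : ('abs x == 0) = (x == 0).
Proof.
rewrite /padic_abs; case: ifP; rewrite ?eqxx // => _.
by apply: negbTE; rewrite expfz_neq0 // gt_eqF.
Qed.

Lemma padic_absM x y : 'abs (x * y) = 'abs x * 'abs y.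
Proof.
rewrite /padic_abs mulf_eq0; case: eqVneq => [|x0]; first by rewrite mul0r.
case: eqVneq => [|y0]; first by rewrite mulr0.
by rewrite padic_valM // opprD expfzDr // gt_eqF.
Qed.

Lemma padic_absN x : 'abs (- x) = 'abs x.
Proof.
by rewrite /padic_abs oppr_eq0 /padic_val numqN denqN abszN.
Qed.

Lemma padic_abs1 : 'abs 1 = 1.
Proof.
have := @padic_val_frac 1 1 isT isT; rewrite mulr1z divr1 subrr => v1.
by rewrite /padic_abs oner_eq0 v1 oppr0.
Qed.

Lemma padic_abs_int (a : int) : 'abs a%:Q <= 1.
Proof.
rewrite /padic_abs; case: ifP => // _.
rewrite /padic_val numq_int denq_int logn1 subr0 -exprnN.
by rewrite invf_le1 ?exprn_gt0 // exprn_ege1 // ltW.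
Qed.

Lemma padic_absV x : 'abs x^-1 = ('abs x)^-1.
Proof.
have [->|x0] := eqVneq x 0; first by rewrite padic_abs0 !invr0 padic_abs0.
have a0 : 'abs x != 0 by rewrite padic_abs_eq0.
by apply: (mulfI a0); rewrite -padic_absM !divff // padic_abs1.
Qed.

Lemma padic_abs_le1 x : 'abs x <= 1 -> 'abs (1 + x) <= 1.
Proof.
have [->|x0] := eqVneq x 0; first by rewrite addr0 padic_abs1.
have d0 : (denq x)%:Q != 0 by rewrite intr_eq0 denq_eq0.
move=> x1; have dx : ~~ (p %| `|denq x|%N)%N.
  apply/negP => pd; move: x1; apply/negP; rewrite -ltNge.
  rewrite /padic_abs (negbTE x0) /padic_val.
  have -> : logn p `|numq x| = 0%N.
    apply/eqP; rewrite -leqn0 leqNgt logn_gt0 mem_primes !negb_and.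
    rewrite orbA; apply/orP; right; apply/negP => pn.
    have := coprime_num_den x; rewrite /coprime => /eqP g.
    have : (p %| gcdn `|numq x| `|denq x|)%N by rewrite dvdn_gcd pn.
    by rewrite g dvdn1 => /eqP pE; move: p_pr; rewrite pE.
  rewrite sub0r opprK -exprnP exprn_egt1 //.
  by rewrite -lt0n logn_gt0 mem_primes p_pr pd absz_gt0 denq_eq0.
have d1 : 'abs (denq x)%:Q = 1.
  rewrite /padic_abs (negbTE d0) /padic_val numq_int denq_int logn1 subr0.
  by rewrite lognE (negbTE dx) !andbF.
have -> : 1 + x = (denq x + numq x)%:Q / (denq x)%:Q.
  by rewrite intrD mulrDl divff // divq_num_den.
by rewrite padic_absM padic_absV d1 invr1 mulr1 padic_abs_int.
Qed.

Lemma padic_absD x y : 'abs (x + y) <= Num.max ('abs x) ('abs y).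
Proof.
wlog xy : x y / 'abs x <= 'abs y.
  by move=> H; case/orP: (le_total ('abs x) ('abs y)) => /H //;
     rewrite addrC maxC.
have [y0|y0] := eqVneq y 0.
  by rewrite y0 addr0 le_max lexx.
rewrite le_max; apply/orP; right.
have ay : 0 < 'abs y by rewrite lt_def padic_abs_ge0 padic_abs_eq0 y0.
have -> : x + y = y * (1 + x / y) by rewrite mulrDr mulr1 mulrCA divff // mulr1 addrC.
rewrite padic_absM -[leRHS]mulr1 ler_pM2l //; apply: padic_abs_le1.
by rewrite padic_absM padic_absV ler_pdivrMr // mul1r.
Qed.

Lemma padic_absB x y : 'abs (x - y) = 'abs (y - x).
Proof. by rewrite -opprB padic_absN. Qed.

Lemma padic_absD_lt x y e : 'abs x < e -> 'abs y < e -> 'abs (x + y) < e.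
Proof. by move=> xe ye; rewrite (le_lt_trans (padic_absD x y)) // gt_max xe. Qed.

Lemma padic_abs_eq x y : 'abs (x - y) < 'abs y -> 'abs x = 'abs y.
Proof.
move=> xy; have /le_anti -> // : 'abs x <= 'abs y <= 'abs x.
apply/andP; split.
  rewrite -[x](subrK y) (le_trans (padic_absD _ _)) // ge_max lexx andbT.
  exact: ltW.
rewrite leNgt; apply/negP => yx.
have := xy; rewrite padic_absB => /padic_absD_lt/(_ yx).
by rewrite subrK ltxx.
Qed.

Lemma padic_abs_pX k : 'abs (p%:Q ^+ k) = p%:Q ^- k.
Proof.
elim: k => [|k IH]; first by rewrite !expr0 padic_abs1 invr1.
rewrite exprS padic_absM IH invfM; congr (_ * _).
rewrite /padic_abs gt_eqF // /padic_val numq_int denq_int logn1 subr0 /=.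
by rewrite logn_prime // eqxx.
Qed.

End PadicAbs.

Definition padic_cauchy (p : nat) (u : nat -> rat) : Prop :=
  forall e : rat, 0 < e -> exists N, forall m n,
    (N <= m)%N -> (N <= n)%N -> padic_abs p (u m - u n) < e.

Definition padic_null (p : nat) (u : nat -> rat) : Prop :=
  forall e : rat, 0 < e -> exists N, forall n,
    (N <= n)%N -> padic_abs p (u n) < e.

Section CauchySequences.
Variables (p : nat) (p_pr : prime p).
Local Notation "'abs" := (padic_abs p).

(* The primality proof is a parameter of the types below so that their
   algebraic structures can be inferred. *)
Record padic_cauchy_seq (pr : prime p) := PadicCauchySeq {
  cauchy_val :> nat -> rat;
  _ : `[< padic_cauchy p cauchy_val >] }.

HB.instance Definition _ := [isSub for @cauchy_val p_pr].
HB.instance Definition _ := [Choice of padic_cauchy_seq p_pr by <:].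

Lemma padic_cauchyP (u : padic_cauchy_seq p_pr) : padic_cauchy p u.
Proof. by case: u => u /= /asboolP. Qed.

Lemma padic_cauchy_bounded u : padic_cauchy p u ->
  exists2 B : rat, 0 < B & forall n, 'abs (u n) < B.
Proof.
move=> /(_ 1 ltr01)[N uN].
pose B := \sum_(i < N.+1) 'abs (u i) + 1.
have leB i : (i <= N)%N -> 'abs (u i) < B.
  move=> iN; rewrite /B (bigD1 (Ordinal (iN : (i < N.+1)%N))) //=.
  rewrite -addrA ltrDl ltr_wpDl // sumr_ge0 // => j _.
  exact: padic_abs_ge0.
exists B; first exact: le_lt_trans (padic_abs_ge0 _ _) (leB 0%N _).
move=> n; have [/leB //|/ltnW Nn] := leqP n N.
rewrite -[u n](subrK (u N)); apply: padic_absD_lt => //; last exact: leB.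
apply: lt_le_trans (uN _ _ Nn (leqnn N)) _.
by rewrite lerDr sumr_ge0 // => j _; exact: padic_abs_ge0.
Qed.

Lemma padic_cauchy_subring :
  subring_closed (fun u : nat -> rat => `[< padic_cauchy p u >]).
Proof.
split.
- apply/asboolP => e e0; exists 0%N => m n _ _.
  by rewrite subrr padic_abs0.
- move=> u v /asboolP cu /asboolP cv; apply/asboolP => e e0.
  have [M uM] := cu e e0; have [N vN] := cv e e0.
  exists (maxn M N) => m n; rewrite !geq_max => /andP[Mm Nm] /andP[Mn Nn].
  have -> : (u - v) m - (u - v) n = (u m - u n) + (v n - v m).
    by rewrite -[(u - v) m]/(u m - v m) -[(u - v) n]/(u n - v n); ring.
  by apply: padic_absD_lt => //; [exact: uM | exact: vN].
- move=> u v /asboolP cu /asboolP cv; apply/asboolP => e e0.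
  have [B B0 uB] := padic_cauchy_bounded cu.
  have [C C0 vC] := padic_cauchy_bounded cv.
  have [M uM] := cu (e / C) (divr_gt0 e0 C0).
  have [N vN] := cv (e / B) (divr_gt0 e0 B0).
  exists (maxn M N) => m n; rewrite !geq_max => /andP[Mm Nm] /andP[Mn Nn].
  have -> : (u * v) m - (u * v) n = (u m - u n) * v m + u n * (v m - v n).
    by rewrite mulrBl mulrBr addrA subrK.
  apply: padic_absD_lt => //; rewrite padic_absM //.
    rewrite -[e](divfK (lt0r_neq0 C0)).
    by apply: ltr_pM => //; rewrite ?padic_abs_ge0 // uM.
  rewrite -[e](divfK (lt0r_neq0 B0)) mulrC.
  by apply: ltr_pM => //; rewrite ?padic_abs_ge0 // vN.
Qed.

HB.instance Definition _ :=
  GRing.SubChoice_isSubComNzRing.Build (nat -> rat) _ (padic_cauchy_seq p_pr)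
    padic_cauchy_subring.

Definition padic_null_ideal : {pred padic_cauchy_seq p_pr} :=
  fun u => `[< padic_null p u >].

Lemma padic_null_ideal_closed : idealr_closed padic_null_ideal.
Proof.
split.
- by apply/asboolP => e e0; exists 0%N => n _; rewrite padic_abs0.
- apply/asboolP => /(_ 1 ltr01)[N /(_ N (leqnn N))].
  by rewrite padic_abs1 ltxx.
- move=> a u v /asboolP nu /asboolP nv; apply/asboolP => e e0.
  have [B B0 aB] := padic_cauchy_bounded (padic_cauchyP a).
  have [M uM] := nu (e / B) (divr_gt0 e0 B0); have [N vN] := nv e e0.
  exists (maxn M N) => n; rewrite geq_max => /andP[Mn Nn].
  rewrite -[X in 'abs X]/(a n * u n + v n).
  apply: padic_absD_lt => //; last exact: vN.
  rewrite padic_absM //.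
  rewrite -[e](divfK (lt0r_neq0 B0)) mulrC.
  by apply: ltr_pM => //; rewrite ?padic_abs_ge0 // uM.
Qed.

HB.instance Definition _ :=
  isIdealr.Build (padic_cauchy_seq p_pr) padic_null_ideal
    padic_null_ideal_closed.

(* The field Q_p of p-adic numbers: p-adic Cauchy sequences of rationals
   modulo null sequences. *)
Definition padic : Type := {ideal_quot padic_null_ideal}.

End CauchySequences.

Arguments PadicCauchySeq {p} pr {cauchy_val} _.
Arguments padic_null_ideal {p} p_pr _.

Section PadicField.
Variables (p : nat) (p_pr : prime p).
Local Open Scope quotient_scope.
Local Notation "'abs" := (padic_abs p).
Local Notation CS := (padic_cauchy_seq p_pr).
Local Notation Qp := (padic p_pr).

HB.instance Definition _ :=
  GRing.ComNzRing.copy Qp {ideal_quot (padic_null_ideal p_pr)}.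
HB.instance Definition _ :=
  EqQuotient.copy Qp {ideal_quot (padic_null_ideal p_pr)}.

Definition padic_class (u : CS) : Qp := \pi_Qp u.

Lemma padic_class_surj (x : Qp) : exists u, x = padic_class u.
Proof. by exists (repr x); rewrite /padic_class reprK. Qed.

Lemma padic_classD u v : padic_class (u + v) = padic_class u + padic_class v.
Proof. exact: (@Quotient.pi_add _ (padic_null_ideal p_pr)). Qed.

Lemma padic_classN u : padic_class (- u) = - padic_class u.
Proof. exact: (@Quotient.pi_opp _ (padic_null_ideal p_pr)). Qed.

Lemma padic_classM u v : padic_class (u * v) = padic_class u * padic_class v.
Proof. exact: (@Quotient.pi_mul _ (padic_null_ideal p_pr)). Qed.

Lemma padic_class1 : padic_class 1 = 1.
Proof.
exact: (@pi_oner _ _ _ _ _ _ _ {ideal_quot (padic_null_ideal p_pr)}).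
Qed.

Lemma padic_class_eq u v :
  padic_class u = padic_class v <-> padic_null p (u - v : CS).
Proof.
have E : (padic_class u == padic_class v) = (u - v \in padic_null_ideal p_pr).
  by rewrite (@Quotient.idealrBE _ (padic_null_ideal p_pr)).
split=> [/eqP|]; first by rewrite E => /asboolP.
by move=> H; apply/eqP; rewrite E; apply/asboolP.
Qed.

Lemma padic_class0 : padic_class 0 = 0.
Proof. by rewrite -[0 in LHS](subrr 0) padic_classD padic_classN subrr. Qed.

Lemma padic_class_eq0 u : padic_class u = 0 <-> padic_null p u.
Proof. by rewrite -padic_class0 padic_class_eq subr0. Qed.

Lemma padic_cauchy_stable u : padic_cauchy p u -> ~ padic_null p u ->
  exists2 c : rat, 0 < c & exists N, forall n, (N <= n)%N -> 'abs (u n) = c.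
Proof.
move=> cu /existsNP[e /not_implyP[e0 /forallNP nu]].
have [N uN] := cu e e0.
have /existsNP[n0 /not_implyP[Nn0 /negP]] := nu N; rewrite -leNgt => en0.
exists ('abs (u n0)); first exact: lt_le_trans en0.
exists N => n Nn; apply: padic_abs_eq => //.
by apply: lt_le_trans en0; exact: uN.
Qed.

Lemma padic_cauchy_inv u : padic_cauchy p u -> ~ padic_null p u ->
  padic_cauchy p (fun n => (u n)^-1).
Proof.
move=> cu nu e e0; have [c c0 [N uN]] := padic_cauchy_stable cu nu.
have [M uM] := cu (e * (c * c)) (mulr_gt0 e0 (mulr_gt0 c0 c0)).
exists (maxn M N) => m n; rewrite !geq_max => /andP[Mm Nm] /andP[Mn Nn].
have um : u m != 0 by rewrite -(padic_abs_eq0 p_pr) uN // gt_eqF.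
have un : u n != 0 by rewrite -(padic_abs_eq0 p_pr) uN // gt_eqF.
have -> : (u m)^-1 - (u n)^-1 = (u n - u m) / (u m * u n).
  by field; rewrite um un.
rewrite padic_absM // padic_absV // padic_absM // !uN //.
by rewrite ltr_pdivrMr ?mulr_gt0 //; exact: uM.
Qed.

Definition padic_inv (x : Qp) : Qp := xget 0 [set y : Qp | y * x = 1].

Lemma padic_mulVf (x : Qp) : x != 0 -> padic_inv x * x = 1.
Proof.
move=> x0; suff : exists y : Qp, y * x = 1.
  by case=> y yx; exact: (@xgetI Qp 0 [set y | y * x = 1] y yx).
have [u xE] := padic_class_surj x.
have nu : ~ padic_null p u.
  by move/padic_class_eq0 => u0; move: x0; rewrite xE u0 eqxx.
have cu := padic_cauchyP u.
pose v : CS := PadicCauchySeq p_pr (introT (asboolP _) (padic_cauchy_inv cu nu)).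
exists (padic_class v); rewrite xE -padic_classM -padic_class1.
apply/padic_class_eq => e e0.
have [c c0 [N uN]] := padic_cauchy_stable cu nu.
exists N => n Nn; rewrite -[X in 'abs X]/((u n)^-1 * u n - 1).
have un : u n != 0 by rewrite -(padic_abs_eq0 p_pr) uN // gt_eqF.
by rewrite mulVf // subrr padic_abs0.
Qed.

Lemma padic_inv0 : padic_inv 0 = 0.
Proof.
apply: xgetPN => y /=; rewrite mulr0 => /esym/eqP.
by rewrite oner_eq0.
Qed.

HB.instance Definition _ :=
  GRing.ComNzRing_isField.Build Qp padic_mulVf padic_inv0.

(* The p-adic absolute value extends to Q_p by continuity; its values stay
   rational. *)
Definition padic_norm (x : Qp) : rat :=
  lim ((fun n => 'abs (repr x n) : rat^o) @ \oo).

Lemma padic_norm0 : padic_norm 0 = 0.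
Proof.
have n0 : padic_null p (repr (0 : Qp)).
  by apply/padic_class_eq0; rewrite /padic_class reprK.
apply: (@cvg_lim rat^o); first exact: norm_hausdorff.
apply/cvgrPdist_lt => e e0.
have [N nN] := n0 e e0; exists N => // n /= Nn.
by rewrite sub0r normrN ger0_norm ?padic_abs_ge0 // nN.
Qed.

Lemma padic_norm_stable (u : CS) c N : 0 < c ->
  (forall n, (N <= n)%N -> 'abs (u n) = c) -> padic_norm (padic_class u) = c.
Proof.
move=> c0 uN; set x := padic_class u.
have /padic_class_eq xu : padic_class (repr x) = padic_class u.
  by rewrite /padic_class reprK.
have [M xM] := xu c c0.
apply: (@cvg_lim rat^o); first exact: norm_hausdorff.
apply: cvg_near_cst; exists (maxn M N) => // n /=.
rewrite geq_max => /andP[Mn Nn]; rewrite -(uN n Nn); apply: padic_abs_eq => //.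
by rewrite uN //; exact: xM.
Qed.

(* A nonzero p-adic number is represented by a sequence of constant absolute
   value from some rank on. *)
Lemma padic_class_stable u : padic_class u != 0 ->
  exists2 c : rat, 0 < c & (exists N, forall n, (N <= n)%N -> 'abs (u n) = c)
    /\ padic_norm (padic_class u) = c.
Proof.
move=> u0; have nu : ~ padic_null p u.
  by move/padic_class_eq0 => uE; rewrite uE eqxx in u0.
have [c c0 [N uN]] := padic_cauchy_stable (padic_cauchyP u) nu.
by exists c => //; split; [exists N | exact: padic_norm_stable uN].
Qed.

Lemma padic_norm_ge0 x : 0 <= padic_norm x.
Proof.
have [->|x0] := eqVneq x 0; first by rewrite padic_norm0.
have [u xE] := padic_class_surj x; rewrite xE in x0 *.
by have [c c0 [_ ->]] := padic_class_stable x0; exact: ltW.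
Qed.

Lemma padic_norm_eq0 x : (padic_norm x == 0) = (x == 0).
Proof.
have [->|x0] := eqVneq x 0; first by rewrite padic_norm0 eqxx.
have [u xE] := padic_class_surj x; rewrite xE in x0 *.
by have [c c0 [_ ->]] := padic_class_stable x0; rewrite gt_eqF.
Qed.

Lemma padic_norm_lt (u : CS) e N : 0 < e ->
  (forall n, (N <= n)%N -> 'abs (u n) < e) -> padic_norm (padic_class u) < e.
Proof.
move=> e0 uN; have [->|u0] := eqVneq (padic_class u) 0.
  by rewrite padic_norm0.
have [c c0 [[M uM] ->]] := padic_class_stable u0.
by rewrite -(uM (maxn M N)) ?leq_maxl // uN // leq_maxr.
Qed.

Lemma padic_normM x y : padic_norm (x * y) = padic_norm x * padic_norm y.
Proof.
have [->|x0] := eqVneq x 0; first by rewrite mul0r !padic_norm0 mul0r.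
have [->|y0] := eqVneq y 0; first by rewrite mulr0 !padic_norm0 mulr0.
have [u xE] := padic_class_surj x; rewrite xE in x0 *.
have [v yE] := padic_class_surj y; rewrite yE in y0 *.
have [c c0 [[M uM] ->]] := padic_class_stable x0.
have [d d0 [[N vN] ->]] := padic_class_stable y0.
rewrite -padic_classM.
apply: (@padic_norm_stable _ _ (maxn M N)); first exact: mulr_gt0.
move=> n; rewrite geq_max => /andP[Mn Nn].
by rewrite -[X in 'abs X]/(u n * v n) padic_absM // uM // vN.
Qed.

Lemma padic_normN x : padic_norm (- x) = padic_norm x.
Proof.
have [->|x0] := eqVneq x 0; first by rewrite oppr0.
have [u xE] := padic_class_surj x; rewrite xE in x0 *.
have [c c0 [[M uM] ->]] := padic_class_stable x0.
rewrite -padic_classN; apply: (@padic_norm_stable _ _ M) => // n Mn.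
by rewrite -[X in 'abs X]/(- u n) padic_absN uM.
Qed.

Lemma padic_normD x y :
  padic_norm (x + y) <= Num.max (padic_norm x) (padic_norm y).
Proof.
have [->|xy0] := eqVneq (x + y) 0.
  by rewrite padic_norm0 le_max padic_norm_ge0.
have [->|x0] := eqVneq x 0; first by rewrite add0r le_max lexx orbT.
have [->|y0] := eqVneq y 0; first by rewrite addr0 le_max lexx.
have [u xE] := padic_class_surj x; rewrite xE in x0 xy0 *.
have [v yE] := padic_class_surj y; rewrite yE in y0 xy0 *.
have [c c0 [[M uM] ->]] := padic_class_stable x0.
have [d d0 [[N vN] ->]] := padic_class_stable y0.
rewrite -padic_classD in xy0 *.
have [f f0 [[K uvK] ->]] := padic_class_stable xy0.
pose n := maxn K (maxn M N).
rewrite -(uvK n) ?leq_maxl // -[X in 'abs X]/(u n + v n).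
rewrite (le_trans (padic_absD p_pr _ _)) //.
by rewrite uM ?vN // /n !leq_max leqnn !orbT.
Qed.

Lemma padic_normD_lt x y e :
  padic_norm x < e -> padic_norm y < e -> padic_norm (x + y) < e.
Proof. by move=> xe ye; rewrite (le_lt_trans (padic_normD x y)) // gt_max xe. Qed.

Lemma padic_normB x y : padic_norm (x - y) = padic_norm (y - x).
Proof. by rewrite -opprB padic_normN. Qed.

Definition padic_dist (x y : Qp) : rat := padic_norm (x - y).

Lemma padic_distxx x : padic_dist x x = 0.
Proof. by rewrite /padic_dist subrr padic_norm0. Qed.

Lemma padic_dist_eq0 x y : padic_dist x y = 0 -> x = y.
Proof. by move/eqP; rewrite padic_norm_eq0 subr_eq0 => /eqP. Qed.

Lemma padic_dist_triangle y x z :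
  padic_dist x z <= padic_dist x y + padic_dist y z.
Proof.
rewrite /padic_dist -(subrK y x) -addrA (le_trans (padic_normD _ _)) //.
by rewrite subrK ge_max lerDl lerDr !padic_norm_ge0.
Qed.

HB.instance Definition _ :=
  isMetric.Build rat Qp padic_distxx padic_dist_eq0 padic_normB
    padic_dist_triangle.
HB.instance Definition _ := isPointed.Build Qp 0.

Lemma padic_ballE (x y : Qp) (e : rat) : ball x e y = (padic_norm (x - y) < e).
Proof. by rewrite ballEmdist. Qed.

Lemma padic_cst_cauchy (q : rat) : padic_cauchy p (fun=> q).
Proof. by move=> e e0; exists 0%N => m n _ _; rewrite subrr padic_abs0. Qed.

Definition padic_cst (q : rat) : CS :=
  PadicCauchySeq p_pr (introT (asboolP _) (padic_cst_cauchy q)).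

Definition padic_of_rat (q : rat) : Qp := padic_class (padic_cst q).

Lemma padic_of_rat_zmod : zmod_morphism padic_of_rat.
Proof.
move=> a b; rewrite /padic_of_rat -padic_classN -padic_classD.
by congr padic_class; apply: val_inj.
Qed.

Lemma padic_of_rat_monoid : monoid_morphism padic_of_rat.
Proof.
split; first by rewrite -padic_class1; congr padic_class; apply: val_inj.
move=> a b; rewrite /padic_of_rat -padic_classM.
by congr padic_class; apply: val_inj.
Qed.

HB.instance Definition _ :=
  GRing.isZmodMorphism.Build rat Qp padic_of_rat padic_of_rat_zmod.
HB.instance Definition _ :=
  GRing.isMonoidMorphism.Build rat Qp padic_of_rat padic_of_rat_monoid.

Lemma padic_ratr (q : rat) : ratr q = padic_of_rat q.
Proof. exact/esym/(fmorph_eq_rat (padic_of_rat : {rmorphism rat -> Qp})). Qed.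

Lemma padic_norm_ratr (q : rat) : padic_norm (ratr q) = 'abs q.
Proof.
rewrite padic_ratr; have [->|q0] := eqVneq q 0.
  by rewrite rmorph0 padic_norm0 padic_abs0.
apply: (@padic_norm_stable _ _ 0%N) => //.
by rewrite lt_def padic_abs_ge0 // padic_abs_eq0 // q0.
Qed.

Lemma padic_class_approx (u : CS) (e : rat) : 0 < e ->
  exists N, forall n, (N <= n)%N -> padic_norm (padic_class u - ratr (u n)) < e.
Proof.
move=> e0; have [N uN] := padic_cauchyP u e0.
exists N => n Nn; rewrite padic_ratr /padic_of_rat -padic_classN -padic_classD.
by apply: (@padic_norm_lt _ _ N) => // m Nm; exact: uN.
Qed.

Lemma padic_rat_dense : dense (range (@ratr Qp)).
Proof.
move=> O [x Ox] oO; have /nbhs_ballP[e /= e0 xeO] : nbhs x O.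
  exact: open_nbhs_nbhs.
have [u xE] := padic_class_surj x.
have [N uN] := padic_class_approx u e0.
exists (ratr (u N)); split; last by exists (u N).
by apply: xeO; rewrite padic_ballE xE uN.
Qed.

Lemma padic_complete (F : set_system Qp) :
  ProperFilter F -> cauchy F -> cvg F.
Proof.
move=> FF /cauchyP Fc.
pose d (k : nat) : rat := k.+1%:R^-1.
have d0 k : 0 < d k by rewrite invr_gt0 ltr0n.
have dle j k : (j <= k)%N -> d k <= d j.
  by move=> jk; rewrite lef_pV2 ?posrE ?ltr0n // ler_nat.
have dlt (e : rat) : 0 < e -> exists k, d k < e.
  move=> e0; exists (Num.truncn e^-1); rewrite invf_plt ?posrE ?ltr0n //.
  exact: truncnS_gt.
have ex k : exists q : rat, F (ball (ratr q : Qp) (d k)).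
  have [x Fx] := Fc _ (d0 k); have [u xE] := padic_class_surj x.
  have [N uN] := padic_class_approx u (d0 k); exists (u N).
  apply: filterS Fx => y; rewrite !padic_ballE xE => xy.
  rewrite -(subrK (padic_class u) (ratr _)) -addrA; apply: padic_normD_lt => //.
  by rewrite padic_normB uN.
have [q Fq] := choice ex.
have qc : padic_cauchy p q.
  move=> e e0; have [k ke] := dlt e e0; exists k => m n km kn.
  have [y []] := filter_ex (filterI (Fq m) (Fq n)).
  rewrite !padic_ballE => my ny.
  rewrite -padic_norm_ratr padic_ratr rmorphB /= -!padic_ratr -(subrK y (ratr _)) -addrA.
  apply: padic_normD_lt.
    by apply: lt_trans ke; apply: lt_le_trans my _; exact: dle.
  rewrite padic_normB.
  by apply: lt_trans ke; apply: lt_le_trans ny _; exact: dle.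
pose u : CS := PadicCauchySeq p_pr (introT (asboolP _) qc).
apply/cvg_ex; exists (padic_class u); apply/fcvg_ballP => e e0.
have [k ke] := dlt e e0; have [N uN] := padic_class_approx u e0.
have Fe := Fq (maxn k N); apply: filterS Fe => y; rewrite !padic_ballE => yq.
rewrite -(subrK (ratr (q (maxn k N))) (padic_class u)) -addrA.
apply: padic_normD_lt; first by apply: uN; exact: leq_maxr.
apply: lt_le_trans yq _; apply: le_trans (ltW ke); apply: dle.
exact: leq_maxl.
Qed.

HB.instance Definition _ := Uniform_isComplete.Build Qp padic_complete.

End PadicField.

(* A field carrying a topology, with no compatibility axiom. *)
#[short(type="preTopologicalFieldType")]
HB.structure Definition PreTopologicalField :=
  {K of GRing.Field K & Topological K}.

HB.instance Definition _ (p : nat) (p_pr : prime p) :=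
  Topological.on (padic p_pr).
HB.instance Definition _ (R : realType) := Topological.on R.

Inductive place : Type :=
| finite_place (p : nat) of prime p
| infinite_place.

Definition completion (R : realType) (v : place) : preTopologicalFieldType :=
  match v with
  | finite_place p p_pr => padic p_pr
  | infinite_place => R
  end.

(* Subgroups of the multiplicative group of Q are given by their underlying
   sets of rational numbers. *)
Definition is_unit_subgroup (G : set rat) : Prop :=
  [/\ ~ G 0, G 1, forall x y, G x -> G y -> G (x * y)
    & forall x, G x -> G x^-1].

Definition finite_index (G : set rat) : Prop :=
  finite_set [set ( *%R x) @` G | x in [set x : rat | x != 0]].

(* The closure in the unit group for the subspace topology, that is, the
   nonzero points of the closure in the whole field. *)
Definition unit_closure (K : preTopologicalFieldType) (G : set rat) : set K :=
  closure ((@ratr K) @` G) `&` [set x : K | x != 0].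

(* Main.v *)
(* Every nonzero rational is a limit, in each completion, of elements of the
   group [G] of rationals whose valuations at 2, 3 and 5 agree modulo 7, so
   the local conditions are vacuous. On the other hand, if [x + b y + c z = 0]
   then at each prime two of the three terms have the same valuation. At 2, 3
   and 5 this gives three linear relations modulo 7 between the classes of
   [x], [y] and [z], and for [b = 54 = 2 * 3^3] and [c = 40 = 2^3 * 5] all 27
   such systems are inconsistent. *)
Require Import Defs.
From mathcomp Require Import all_boot all_order all_algebra.
From mathcomp Require Import all_classical all_reals topology normedtype.
From mathcomp Require Import zify ring lra.

Set Implicit Arguments.
Unset Strict Implicit.
Unset Printing Implicit Defensive.

Import Order.TTheory GRing.Theory Num.Theory.
Import numFieldNormedType.Exports.

Local Open Scope classical_set_scope.
Local Open Scope ring_scope.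

(** * Arithmetic of valuations on the rationals *)

Section PadicVal.
Variables (p : nat) (p_pr : prime p).

Lemma padic_val_int (a : int) : padic_val p a%:Q = (logn p `|a|)%:Z.
Proof. by rewrite /padic_val numq_int denq_int logn1 subr0. Qed.

Lemma padic_val_int_ndvd (a : int) : ~~ (p %| a)%Z -> padic_val p a%:Q = 0.
Proof.
by rewrite dvdzE => pa; rewrite padic_val_int lognE (negbTE pa) !andbF.
Qed.

Lemma padic_valV x : x != 0 -> padic_val p x^-1 = - padic_val p x.
Proof.
move=> x0; have := @padic_valM p x x^-1 x0; rewrite invr_eq0 => /(_ x0).
rewrite divff // -[1]/(1%:Q) padic_val_int logn1.
by move=> /esym/eqP; rewrite addrC addr_eq0 => /eqP.
Qed.

Lemma padic_valXz x (j : int) : x != 0 ->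
  padic_val p (x ^ j) = j * padic_val p x.
Proof.
move=> x0.
have valX n : padic_val p (x ^+ n) = n%:Z * padic_val p x.
  elim: n => [|n IH].
    by rewrite expr0 mul0r -[1]/(1%:Q) padic_val_int logn1.
  by rewrite exprS padic_valM ?expf_neq0 // IH intS mulrDl mul1r.
case: j => n; first by rewrite -exprnP valX.
by rewrite NegzE -exprnN padic_valV ?expf_neq0 // valX mulNr.
Qed.

Lemma padic_abs_gt0 x : (0 < padic_abs p x) = (x != 0).
Proof. by rewrite lt_def padic_abs_eq0 // padic_abs_ge0 // andbT. Qed.

Lemma eq_padic_abs_val x y : x != 0 -> y != 0 ->
  padic_abs p x = padic_abs p y -> padic_val p x = padic_val p y.
Proof.
move=> x0 y0; rewrite /padic_abs (negbTE x0) (negbTE y0).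
move/(ieexprIz _ _) => E; apply: oppr_inj; apply: E.
- by rewrite ltr0n prime_gt0.
- by rewrite gt_eqF // ltr1n prime_gt1.
Qed.

(* Two of the three terms of a vanishing sum are of maximal absolute value. *)
Lemma padic_val_sum0 x y z : x != 0 -> y != 0 -> z != 0 -> x + y + z = 0 ->
  [\/ padic_val p x = padic_val p y, padic_val p y = padic_val p z
    | padic_val p x = padic_val p z].
Proof.
move=> x0 y0 z0 xyz.
have absz u v : u + v + z = 0 -> padic_abs p u < padic_abs p v ->
    padic_abs p v = padic_abs p z.
  move=> uvz uv; rewrite -(@padic_absN p z); apply/esym/(padic_abs_eq p_pr).
  by rewrite (_ : - z - v = u) //; lra.
have [xy|yx|] := ltgtP (padic_abs p x) (padic_abs p y).
- by apply: Or32; apply: eq_padic_abs_val => //; exact: absz xy.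
- by apply: Or33; apply: eq_padic_abs_val => //; apply: absz yx; lra.
- by move/(eq_padic_abs_val x0 y0); exact: Or31.
Qed.

End PadicVal.

(** * The group and its index *)

Definition eqval_group : set rat :=
  [set x | x != 0 /\ {in [:: 2; 3; 5]%N &, forall p q : nat,
     (7 %| padic_val p x - padic_val q x)%Z}].

Lemma prime235 p : p \in [:: 2; 3; 5]%N -> prime p.
Proof. by rewrite !inE => /or3P[]/eqP->. Qed.

(** All the congruences follow from the two that compare 2 with 3 and with 5. *)
Lemma eqval_groupP x : eqval_group x <->
  [/\ x != 0, (7 %| padic_val 2 x - padic_val 3 x)%Z
    & (7 %| padic_val 2 x - padic_val 5 x)%Z].
Proof.
split=> [[x0 Gx]|[x0 H1 H2]]; first by split=> //; exact: Gx.
by split=> // p q; rewrite !inE => /or3P[]/eqP-> /or3P[]/eqP->; lia.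
Qed.

Lemma eqval_group_subgroup : is_unit_subgroup eqval_group.
Proof.
split.
- by case; rewrite eqxx.
- by split=> // p q _ _; rewrite -[1]/(1%:Q) !padic_val_int !logn1.
- move=> x y [x0 Gx] [y0 Gy]; split; first by rewrite mulf_neq0.
  move=> p q pS qS; rewrite !padic_valM // opprD addrACA.
  by rewrite rpredD ?Gx ?Gy.
- move=> x [x0 Gx]; split; first by rewrite invr_eq0.
  by move=> p q pS qS; rewrite !padic_valV // -opprD rpredN Gx.
Qed.

(** A coset is determined by the residues modulo 7 of [v_2 - v_3] and [v_2 - v_5], so it is one of
    the 49 sets [h t]. *)
Lemma eqval_group_finite_index : finite_index eqval_group.
Proof.
pose h (t : 'I_7 * 'I_7) : set rat := [set y |
  [/\ y != 0, (7 %| padic_val 2 y - padic_val 3 y - t.1%:Z)%Z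
    & (7 %| padic_val 2 y - padic_val 5 y - t.2%:Z)%Z]].
apply: (@sub_finite_set _ _ (h @` setT)); last exact/finite_image/finite_finset.
move=> _ [x /= x0 <-].
pose r (p : nat) : 'I_7 := inord `|((padic_val 2 x - padic_val p x) %% 7)%Z|%N.
have rE p : (7 %| padic_val 2 x - padic_val p x - (r p)%:Z)%Z.
  by rewrite /r inordK; lia.
exists (r 3%N, r 5%N) => //.
apply/seteqP; split=> [y [y0 /= y3 y5]|_ [g Gg <-]].
  exists (y / x); last by rewrite mulrC divfK.
  apply/eqval_groupP; rewrite mulf_neq0 ?invr_eq0 //.
  rewrite !padic_valM ?invr_eq0 // !padic_valV //.
  by have := (rE 3%N, rE 5%N) => -[? ?]; split=> //; lia.
have /eqval_groupP[g0 g3 g5] := Gg.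
have := (rE 3%N, rE 5%N) => -[? ?].
by split; rewrite /= ?mulf_neq0 // !padic_valM //; lia.
Qed.

(** * Density of the group at every place *)

Lemma padic_abs_pX_small p (e : rat) : prime p -> 0 < e ->
  exists m, padic_abs p (p%:Q ^+ m) < e.
Proof.
(* The exponent [m] exceeds [e^-1], and [m < p ^ m]. *)
move=> p_pr e0; exists (Num.truncn e^-1).+1; rewrite padic_abs_pX //.
rewrite invf_plt ?posrE ?exprn_gt0 ?ltr0n ?prime_gt0 //.
apply: lt_trans (truncnS_gt _) _.
by rewrite -natrX ltr_nat ltn_expl // prime_gt1.
Qed.

Lemma ndvdz_addX p q m (a : int) : prime p -> prime q -> q != p ->
  (q %| a)%Z -> ~~ (q %| a + (p ^ m)%N)%Z.
Proof.
move=> p_pr q_pr qp qa; rewrite rpredDl //.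
by rewrite dvdzE /= Euclid_dvdX // dvdn_prime2 // (negbTE qp).
Qed.

(** Write [x = c * (A / B)] with [c] of the desired common valuation at 2, 3 and 5, and add a high
    power of [p] to [A] and to [B]: this is a small change at [p], yet it removes the contribution
    of [A / B] to the valuations at the other two or three primes. *)
Lemma eqval_group_padic_dense p (x e : rat) : prime p -> x != 0 -> 0 < e ->
  exists2 g, eqval_group g & padic_abs p (x - g) < e.
Proof.
move=> p_pr x0 e0.
(* An element close to [x] has the valuation of [x] at [p], which forces the common value [j] if [p]
   is 2, 3 or 5. Otherwise [j] is free. *)
pose j : int := if p \in [:: 2; 3; 5]%N then padic_val p x else 0.
have [c c0 valc] : exists2 c : rat, c != 0 &
    {in [:: 2; 3; 5]%N, forall q : nat, padic_val q c = j}.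
  exists (30%:Z%:Q ^ j); first by rewrite expfz_neq0 ?intr_eq0.
  move=> q qS; rewrite padic_valXz ?intr_eq0 // padic_val_int.
  by move: qS; rewrite !inE => /or3P[]/eqP->; rewrite mulr1.
have [A [B [B0 xE A235 B235]]] : exists A B : int,
    [/\ B%:Q != 0, x = c * (A%:Q / B%:Q),
      {in [:: 2; 3; 5]%N, forall q : nat, (q %| A)%Z}
    & {in [:: 2; 3; 5]%N, forall q : nat, (q %| B)%Z}].
  exists (numq (x / c) * 30%:Z), (denq (x / c) * 30%:Z); split.
  - by rewrite intr_eq0 mulf_neq0 ?denq_eq0.
  - rewrite !intrM -mulf_div divff ?intr_eq0 // mulr1 divq_num_den.
    by rewrite mulrC divfK.
  - by move=> q; rewrite !inE => /or3P[]/eqP->; rewrite dvdz_mull.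
  - by move=> q; rewrite !inE => /or3P[]/eqP->; rewrite dvdz_mull.
(* Once [p ^ m] is smaller than [B] at [p], the error is exactly [C] times the absolute value of
   [p ^ m]. As [C] may vanish, the bound divides by [C + 1]. *)
pose C := padic_abs p (c * (A%:Q / B%:Q - 1) / B%:Q).
(* An error below the absolute value of [x] preserves the valuation at [p]. *)
pose d := Num.min e (padic_abs p x).
have ax0 : 0 < padic_abs p x by rewrite padic_abs_gt0.
have d0 : 0 < d by rewrite lt_min e0.
have C0 : 0 <= C by exact: padic_abs_ge0.
have aB0 : 0 < padic_abs p B%:Q by rewrite padic_abs_gt0.
have [m] : exists m, padic_abs p (p%:Q ^+ m) <
    Num.min (padic_abs p B%:Q) (d / (C + 1)).
  apply: padic_abs_pX_small => //; rewrite lt_min aB0 divr_gt0 //.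
  by rewrite ltr_wpDl.
rewrite lt_min => /andP[mB mC].
have intE (a : int) : (a + (p ^ m)%N)%:Q = a%:Q + p%:Q ^+ m.
  by rewrite intrD -[((p ^ m)%N : int)%:~R]/((p ^ m)%:R) natrX.
have aBm : padic_abs p (B%:Q + p%:Q ^+ m) = padic_abs p B%:Q.
  by apply: padic_abs_eq => //; rewrite addrC addKr.
have Bm0 : B%:Q + p%:Q ^+ m != 0.
  by rewrite -(padic_abs_eq0 p_pr) aBm gt_eqF.
(* Since 2, 3 and 5 divide [A] and [B], both terms of this quotient are units
   at the primes 2, 3, 5 other than [p]. *)
pose u := (A%:Q + p%:Q ^+ m) / (B%:Q + p%:Q ^+ m).
have xg : padic_abs p (x - c * u) < d.
  have -> : x - c * u =
      c * (A%:Q / B%:Q - 1) / (B%:Q + p%:Q ^+ m) * p%:Q ^+ m.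
    by rewrite /u xE; field; rewrite Bm0 B0.
  rewrite padic_absM // padic_absM // padic_absV // aBm.
  rewrite -padic_absV // -padic_absM //.
  apply: le_lt_trans (_ : _ <= (C + 1) * padic_abs p (p%:Q ^+ m)) _.
    by rewrite ler_wpM2r ?padic_abs_ge0 // lerDl.
  by rewrite mulrC -ltr_pdivlMr // ltr_wpDl.
move: xg; rewrite lt_min => /andP[xge xgx].
exists (c * u) => //.
have agx : padic_abs p (c * u) = padic_abs p x.
  by apply: padic_abs_eq => //; rewrite padic_absB.
have g0 : c * u != 0 by rewrite -(padic_abs_eq0 p_pr) agx gt_eqF.
have vE q : q \in [:: 2; 3; 5]%N -> padic_val q (c * u) = j.
  move=> qS; have [qp|qp] := eqVneq q p.
    by rewrite qp (eq_padic_abs_val _ g0 x0 agx) // /j -qp qS.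
  have q_pr := prime235 qS.
  move: g0; rewrite mulf_eq0 negb_or => /andP[? u0].
  have := u0; rewrite mulf_eq0 negb_or => /andP[Am0 _].
  rewrite padic_valM // valc // padic_valM ?invr_eq0 // padic_valV //.
  rewrite -!intE !padic_val_int_ndvd ?subrr ?addr0 // ndvdz_addX //.
    exact: B235.
  exact: A235.
by split=> // q s qS sS; rewrite !vE // subrr.
Qed.

(** With [x = A / B] and 30 dividing both [A] and [B], the quotient [(A k + 1) / (B k + 1)] is a
    unit at 2, 3 and 5 and tends to [x] as [k] grows. *)
Lemma eqval_group_real_dense (x e : rat) : 0 < e ->
  exists2 g, eqval_group g & `|x - g| < e.
Proof.
(* The error will be [(x - 1) / (B k + 1)], so [k] is taken above [|x - 1| / e]. *)
move=> e0; pose k : int := (Num.truncn (`|x - 1| / e)).+1.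
pose A := numq x * 30%:Z; pose B := denq x * 30%:Z.
have unit235 (a : int) p : p \in [:: 2; 3; 5]%N ->
    ~~ (p %| a * 30%:Z * k + 1)%Z.
  by rewrite !inE => /or3P[]/eqP->; lia.
have nz (a : int) : (a * 30%:Z * k + 1)%:Q != 0.
  by rewrite intr_eq0; lia.
exists ((A * k + 1)%:Q / (B * k + 1)%:Q).
  split; first by rewrite mulf_neq0 ?invr_eq0 ?nz.
  move=> p q pS qS; rewrite !padic_valM ?padic_valV ?invr_eq0 ?nz //.
  by rewrite !padic_val_int_ndvd ?unit235.
have B0 : 0 < B by rewrite pmulr_rgt0.
have Bk0 : 0 < (B * k + 1)%:Q by rewrite ltr0z ltr_wpDl // mulr_ge0 // ltW.
have xB : x * B%:Q = A%:Q by rewrite !intrM mulrA -numqE.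
have -> : x - (A * k + 1)%:Q / (B * k + 1)%:Q = (x - 1) / (B * k + 1)%:Q.
  apply: (mulIf (lt0r_neq0 Bk0)); rewrite mulrBl !divfK ?lt0r_neq0 //.
  by rewrite !intrD (intrM _ A) (intrM _ B) -xB; ring.
rewrite normrM normfV (gtr0_norm Bk0) ltr_pdivrMr // mulrC -ltr_pdivrMr //.
apply: lt_trans (truncnS_gt _) _.
rewrite -[X in X < _]/(k%:Q) ltr_int.
by nia.
Qed.

Lemma eqval_group_closure (R : realType) (v : place) (x : rat) : x != 0 ->
  unit_closure eqval_group (ratr x : completion R v).
Proof.
case: v => [p p_pr|] x0; split.
- move=> U /nbhs_ballP[e /= e0 xU].
  have [g Gg xg] := eqval_group_padic_dense p_pr x0 e0.
  exists (ratr g); split; first by exists g.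
  apply: xU; rewrite padic_ballE !padic_ratr -rmorphB /= -padic_ratr.
  by rewrite padic_norm_ratr.
- by rewrite /= padic_ratr fmorph_eq0.
- move=> U /(@nbhs_ballP R R)[e /= e0 xU].
  (* The real radius is shrunk to a positive rational one. *)
  have [d /itvP de] := rat_in_itvoo e0.
  have d0 : 0 < d by rewrite -(ltr0q R) de.
  have [g Gg xg] := eqval_group_real_dense x d0.
  exists (ratr g); split; first by exists g.
  apply: xU; rewrite /ball /= -rmorphB /= -ratr_norm.
  by apply: (@lt_trans _ _ (ratr d)); rewrite ?ltr_rat ?de.
- by rewrite /= fmorph_eq0.
Qed.

(** * The global obstruction and the conclusion *)

(** Modulo 7 the ties at 2, 3, 5 prescribe [x - y] as 1, 3, 0, or [y - z] as 2, -3, 1, or [x - z] as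
    3, 0, 1. The values for one difference are distinct, so the three primes must tie three
    different pairs. Then [(x - y) + (y - z) = x - z] fails in all six cases, by a nonzero amount of
    size at most 6. *)
Lemma no_common_ties (x2 x3 x5 y2 y3 y5 z2 z3 z5 : int) :
  (7 %| x2 - x3)%Z -> (7 %| x2 - x5)%Z ->
  (7 %| y2 - y3)%Z -> (7 %| y2 - y5)%Z ->
  (7 %| z2 - z3)%Z -> (7 %| z2 - z5)%Z ->
  [\/ x2 = 1 + y2, 1 + y2 = 3 + z2 | x2 = 3 + z2] ->
  [\/ x3 = 3 + y3, 3 + y3 = z3 | x3 = z3] ->
  [\/ x5 = y5, y5 = 1 + z5 | x5 = 1 + z5] -> False.
Proof.
move=> /dvdzP[? ?] /dvdzP[? ?] /dvdzP[? ?] /dvdzP[? ?] /dvdzP[? ?] /dvdzP[? ?].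
by case=> ?; case=> ?; case=> ?; lia.
Qed.

Theorem proposition9 :
  exists (G : set rat) (a b c : int),
    [/\ is_unit_subgroup G, finite_index G, [/\ a != 0, b != 0 & c != 0],
        ~ (exists x y z : rat,
             [/\ G x, G y, G z & a%:~R * x + b%:~R * y + c%:~R * z = 0])
      & forall (R : realType) (v : place),
          exists x y z : completion R v,
            [/\ unit_closure G x, unit_closure G y, unit_closure G z
              & a%:~R * x + b%:~R * y + c%:~R * z = 0]].
Proof.
exists eqval_group, 1, 54%:Z, 40%:Z; split=> //.
- exact: eqval_group_subgroup.
- exact: eqval_group_finite_index.
- have [v2b v3b v5b] : [/\ padic_val 2 54%:Z%:~R = 1,
      padic_val 3 54%:Z%:~R = 3 & padic_val 5 54%:Z%:~R = 0].
    by split; rewrite padic_val_int.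
  have [v2c v3c v5c] : [/\ padic_val 2 40%:Z%:~R = 3,
      padic_val 3 40%:Z%:~R = 0 & padic_val 5 40%:Z%:~R = 1].
    by split; rewrite padic_val_int.
  have b0 : 54%:Z%:~R != 0 :> rat by rewrite intr_eq0.
  have c0 : 40%:Z%:~R != 0 :> rat by rewrite intr_eq0.
  (* From here on, only the valuations of 54 and 40 and their being nonzero are used. *)
  move: (54%:Z%:~R) (40%:Z%:~R) v2b v3b v5b v2c v3c v5c b0 c0.
  move=> b c v2b v3b v5b v2c v3c v5c b0 c0.
  move=> [x [y [z [/eqval_groupP[x0 x3 x5] /eqval_groupP[y0 y3 y5]]]]].
  move=> /eqval_groupP[z0 z3 z5].
  rewrite mul1r => xyz.
  have by0 : b * y != 0 by rewrite mulf_neq0.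
  have cz0 : c * z != 0 by rewrite mulf_neq0.
  have tie2 := @padic_val_sum0 2 isT x _ _ x0 by0 cz0 xyz.
  have tie3 := @padic_val_sum0 3 isT x _ _ x0 by0 cz0 xyz.
  have tie5 := @padic_val_sum0 5 isT x _ _ x0 by0 cz0 xyz.
  rewrite !padic_valM // v2b v2c in tie2.
  rewrite !padic_valM // v3b v3c add0r in tie3.
  rewrite !padic_valM // v5b v5c add0r in tie5.
  exact: no_common_ties x3 x5 y3 y5 z3 z5 tie2 tie3 tie5.
- move=> R v.
  have clos (n : int) : n != 0 ->
      unit_closure eqval_group (n%:~R : completion R v).
    move=> n0; rewrite -ratr_int.
    by apply: eqval_group_closure; rewrite intr_eq0.
  (* A nonzero rational solution serves at all places: [-94 + 54 + 40 = 0]. *)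
  exists (- 94%:Z)%:~R, 1%:~R, 1%:~R; split; try exact: clos.
  by rewrite -!intrM -!intrD.
Qed.
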